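(* Let $K_i=[a_i,b_i,c_i,d_i]$, $i=1,2,3$, be three oriented circles (or lines) such that $U\neq 0$, and let $\kappa\in\mathbb{R}$ (playing the role of $\cos\Psi_0$; $|\kappa|>1$ is allowed). Put $$D=\tfrac14U(1-\kappa^2)+Q_1Q_2Q_3\,\kappa^2 .$$ Then oriented circles (or lines) $K_0=[a_0,b_0,c_0,d_0]$ with $1-2Q(K_i,K_0)=\kappa$ for $i=1,2,3$ exist if and only if $D\ge0$, and in that case they are exactly the curves $K_0^{\pm}(\kappa)$ given by $$a_0=\frac1U\Big(\kappa\sum a_i v_j\pm\Delta_4\sqrt{D}\Big),\qquad b_0=\frac1U\Big(\kappa\sum b_i v_j\pm\Delta_2\sqrt{D}\Big),$$ $$c_0=\frac1U\Big(\kappa\sum c_i v_j\pm\Delta_3\sqrt{D}\Big),\qquad d_0=\frac1U\Big(\kappa\sum d_i v_j\pm\Delta_1\sqrt{D}\Big),$$ with the same choice of sign (the superscript of $K_0^\pm(\kappa)$) in all four formulas, where each sum runs over $(i,j,k)\in\{(1,2,3),(2,3,1),(3,1,2)\}$. Moreover, $K_0^{+}(\kappa)$ is the reverse of $K_0^{-}(-\kappa)$.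
   Context: An oriented circle or line is a quadruple of reals $K=[a,b,c,d]$ with $b^2+c^2-ad=1$, representing the curve $N(x,y)=a(x^2+y^2)+2bx+2cy+d=0$. Here $a$ is its signed curvature: for $a\ne0$ it is the circle of radius $1/|a|$ centred at $(-b/a,-c/a)$, for $a=0$ it is a straight line. The orientation is such that points with $N<0$ lie to the left of the curve. The reverse of $[a,b,c,d]$ is $[-a,-b,-c,-d]$. The inversive invariant of two oriented circles or lines is defined by $4Q(K_1,K_2)=2+a_1d_2+a_2d_1-2(b_1b_2+c_1c_2)$; the (real or imaginary) intersection angle $\Psi$ is given by $\cos\Psi=1-2Q$. Notation for a triple $K_1,K_2,K_3$: $Q_1=Q(K_1,K_2)$, $Q_2=Q(K_2,K_3)$, $Q_3=Q(K_3,K_1)$; $$U=Q_1^2+Q_2^2+Q_3^2-2(Q_1Q_2+Q_2Q_3+Q_3Q_1)+4Q_1Q_2Q_3;$$ $v_i=Q_i(Q_i-Q_j-Q_k)$ for $\{i,j,k\}=\{1,2,3\}$. Writing $\det(p_i\ q_i\ r_i)$ for the $3\times3$ determinant whose $i$-th row is $(p_i,q_i,r_i)$, $i=1,2,3$: $$\Delta_4=\det(a_i\ b_i\ c_i),\quad \Delta_1=-\det(b_i\ c_i\ d_i),\quad \Delta_2=-\tfrac12\det(a_i\ c_i\ d_i),\quad \Delta_3=\tfrac12\det(a_i\ b_i\ d_i).$$ *)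

(* Defs.v *)
From mathcomp Require Import all_boot all_order all_algebra.
From mathcomp Require Import reals.

Set Implicit Arguments.
Unset Strict Implicit.
Unset Printing Implicit Defensive.

Import Order.TTheory GRing.Theory Num.Theory.
Local Open Scope ring_scope.

(* [a, b, c, d] stands for a (x^2 + y^2) + 2 b x + 2 c y + d = 0; it is an
   oriented circle (a <> 0) or line (a = 0) when normalized, see [oriented].
   Opposite quadruples are the same point set with opposite orientations, so
   equality of oriented curves is equality of quadruples. *)
Record quadruple (R : realType) := Quadruple {
  ca : R; cb : R; cc : R; cd : R
}.

Definition oriented (R : realType) (K : quadruple R) : Prop :=
  cb K ^+ 2 + cc K ^+ 2 - ca K * cd K = 1.

Definition reverse (R : realType) (K : quadruple R) : quadruple R :=
  Quadruple (- ca K) (- cb K) (- cc K) (- cd K).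

Definition invQ (R : realType) (K1 K2 : quadruple R) : R :=
  (2 + ca K1 * cd K2 + ca K2 * cd K1
     - 2 * (cb K1 * cb K2 + cc K1 * cc K2)) / 4.

(* A triple K_1, K_2, K_3 is indexed by 'I_3 (so from 0), and [ordS] is the
   cyclic successor: (i, ordS i, ordS (ordS i)) runs over the cyclic
   permutations of the three indices. *)
Definition tripleQ (R : realType) (K : 'I_3 -> quadruple R) (i : 'I_3) : R :=
  invQ (K i) (K (ordS i)).

Definition tripleU (R : realType) (K : 'I_3 -> quadruple R) : R :=
  \sum_(i < 3) tripleQ K i ^+ 2
  - 2 * (\sum_(i < 3) tripleQ K i * tripleQ K (ordS i))
  + 4 * \prod_(i < 3) tripleQ K i.

Definition triplev (R : realType) (K : 'I_3 -> quadruple R) (i : 'I_3) : R :=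
  tripleQ K i *
    (tripleQ K i - tripleQ K (ordS i) - tripleQ K (ordS (ordS i))).

(* Determinant with i-th row (p (K i), q (K i), r (K i)). *)
Definition det3 (R : realType) (K : 'I_3 -> quadruple R)
    (p q r : quadruple R -> R) : R :=
  \det (\matrix_(i < 3, j < 3) tnth [tuple p (K i); q (K i); r (K i)] j).

Definition Delta1 (R : realType) (K : 'I_3 -> quadruple R) : R :=
  - det3 K (@cb R) (@cc R) (@cd R).
Definition Delta2 (R : realType) (K : 'I_3 -> quadruple R) : R :=
  - (1 / 2) * det3 K (@ca R) (@cc R) (@cd R).
Definition Delta3 (R : realType) (K : 'I_3 -> quadruple R) : R :=
  1 / 2 * det3 K (@ca R) (@cb R) (@cd R).
Definition Delta4 (R : realType) (K : 'I_3 -> quadruple R) : R :=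
  det3 K (@ca R) (@cb R) (@cc R).

Definition discrD (R : realType) (K : 'I_3 -> quadruple R) (kappa : R) : R :=
  1 / 4 * tripleU K * (1 - kappa ^+ 2)
  + (\prod_(i < 3) tripleQ K i) * kappa ^+ 2.

(* The curve with the sign [s] (1 or -1) in front of the square root.
   [Num.sqrt] is 0 on negative reals, so this is only meaningful when
   [0 <= discrD K kappa]. *)
Definition K0_sign (R : realType) (s : R) (K : 'I_3 -> quadruple R)
    (kappa : R) : quadruple R :=
  let coord (p : quadruple R -> R) (Delta : R) :=
    1 / tripleU K *
      (kappa * (\sum_(i < 3) p (K i) * triplev K (ordS i))
       + s * (Delta * Num.sqrt (discrD K kappa))) in
  Quadruple (coord (@ca R) (Delta4 K)) (coord (@cb R) (Delta2 K))
            (coord (@cc R) (Delta3 K)) (coord (@cd R) (Delta1 K)).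

Definition K0_plus (R : realType) (K : 'I_3 -> quadruple R) (kappa : R) :=
  K0_sign 1 K kappa.
Definition K0_minus (R : realType) (K : 'I_3 -> quadruple R) (kappa : R) :=
  K0_sign (-1) K kappa.

Definition is_solution (R : realType) (K : 'I_3 -> quadruple R) (kappa : R)
    (K0 : quadruple R) : Prop :=
  oriented K0 /\ forall i : 'I_3, 1 - 2 * invQ (K i) K0 = kappa.

(* Main.v *)
Require Import Defs.
From mathcomp Require Import all_boot all_order all_algebra.
From mathcomp Require Import reals ring.
Import Order.TTheory GRing.Theory Num.Theory.
Local Open Scope ring_scope.

(** Quadruples [a, b, c, d] form R^4 with the quadratic form b^2 + c^2 - a d, of
    signature (3, 1); let <X, Y> be its polar form.  Oriented circles and lines
    are then the vectors with <X, X> = 1, and 1 - 2 Q(X, Y) = <X, Y>.  So a solution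
    is a unit vector on the affine line cut out by the three linear equations
    <K_i, X> = kappa.

    This line has the direction N = [Delta_4, Delta_2, Delta_3, Delta_1], the
    cross product of K_1, K_2, K_3 for the form: <N, K_i> = 0 because a
    determinant with two equal rows vanishes.  The Gram
    determinant gives <N, N> = - det <K_i, K_j> = 4 U.  As U != 0, N is not
    isotropic, and two vectors with the same products with the K_i differ by
    a multiple of N ([normal_span]).  The point of the line orthogonal to N is
    (kappa / U) S with S = sum K_i v_j, since <S, K_i> = U for each i: up to the
    factor U, S is the sum of the dual basis of the K_i.

    It remains to normalize.  On (kappa / U) S + (t / U) N the form takes the
    value (kappa^2 <S, S> + 4 U t^2) / U^2, where
    <S, S> = U (U - 4 Q_1 Q_2 Q_3), and this equals 1 exactly when t^2 = D
    ([oriented_angle_line]).  Hence solutions correspond to square roots t of D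
    ([solutionE]): there are some if and only if D is nonnegative, and the two
    signs are the two roots.  Reversal replaces (kappa, t) by (- kappa, - t) and
    D is even in kappa, whence the relation between K_0^+ and K_0^-. *)

(** * Cyclic triples *)

Definition i0 : 'I_3 := @Ordinal 3 0 isT.
Definition i1 : 'I_3 := @Ordinal 3 1 isT.
Definition i2 : 'I_3 := @Ordinal 3 2 isT.

Lemma big_cycle3 (T : Type) (idx : T) (op : Monoid.law idx) (F : 'I_3 -> T) :
  \big[op/idx]_(i < 3) F i = op (F i0) (op (F i1) (F i2)).
Proof.
rewrite !big_ord_recl big_ord0 Monoid.mulm1.
by congr (op (F _) (op (F _) (F _))); apply: val_inj.
Qed.

Lemma ordS3 : (ordS i0 = i1) * (ordS i1 = i2) * (ordS i2 = i0).
Proof. by do !split; apply: val_inj. Qed.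

Lemma ord3_ind (P : 'I_3 -> Prop) : P i0 -> P i1 -> P i2 -> forall i, P i.
Proof.
move=> P0 P1 P2 [[|[|[|//]]] lti].
- by rewrite (_ : Ordinal lti = i0) //; apply: val_inj.
- by rewrite (_ : Ordinal lti = i1) //; apply: val_inj.
- by rewrite (_ : Ordinal lti = i2) //; apply: val_inj.
Qed.

Lemma det3E (R : realType) (K : 'I_3 -> quadruple R) (p q r : quadruple R -> R) :
  det3 K p q r =
    p (K i0) * (q (K i1) * r (K i2) - q (K i2) * r (K i1))
  - q (K i0) * (p (K i1) * r (K i2) - p (K i2) * r (K i1))
  + r (K i0) * (p (K i1) * q (K i2) - p (K i2) * q (K i1)).
Proof.
rewrite /det3 (expand_det_row _ i0) big_cycle3 /cofactor.
rewrite !(expand_det_row _ (0 : 'I_2)) !big_ord_recl !big_ord0 /cofactor.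
rewrite !det_mx11 !mxE !(tnth_nth 0) /=.
have e1 : lift i0 (0 : 'I_2) = i1 by apply: val_inj.
have e2 : lift i0 (lift (0 : 'I_2) (0 : 'I_1)) = i2 by apply: val_inj.
by rewrite e1 e2 /bump /=; ring.
Qed.

(** * The Lorentzian form on quadruples *)

Section Form.
Variable R : realType.
Implicit Types (X Y Z : quadruple R) (K : 'I_3 -> quadruple R).

Definition form X Y : R :=
  cb X * cb Y + cc X * cc Y - (ca X * cd Y + cd X * ca Y) / 2.

Definition lincomb (x : R) X (y : R) Y : quadruple R :=
  Quadruple (x * ca X + y * ca Y) (x * cb X + y * cb Y)
            (x * cc X + y * cc Y) (x * cd X + y * cd Y).

Lemma formC X Y : form X Y = form Y X.
Proof. by rewrite /form; ring. Qed.

Lemma form_lincombl x X y Y Z :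
  form (lincomb x X y Y) Z = x * form X Z + y * form Y Z.
Proof. by rewrite /form /=; field. Qed.

Lemma form_lincombr x X y Y Z :
  form Z (lincomb x X y Y) = x * form Z X + y * form Z Y.
Proof. by rewrite formC form_lincombl !(formC Z). Qed.

Lemma orientedE X : oriented X <-> form X X = 1.
Proof.
rewrite /oriented.
by have -> : cb X ^+ 2 + cc X ^+ 2 - ca X * cd X = form X X
  by rewrite /form; field.
Qed.

Lemma cos_invQ X Y : 1 - 2 * invQ X Y = form X Y.
Proof. by rewrite /invQ /form; field. Qed.

(** * The normal vector *)

(** The cross product of the three circles for [form]; the factors 1/2 in
    [Delta2] and [Delta3] come from the weight of the products a d in the form. *)
Definition normal K : quadruple R :=
  Quadruple (Delta4 K) (Delta2 K) (Delta3 K) (Delta1 K).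

Definition gramdet K : R :=
    form (K i0) (K i0) * form (K i1) (K i1) * form (K i2) (K i2)
  + 2 * form (K i0) (K i1) * form (K i1) (K i2) * form (K i2) (K i0)
  - form (K i0) (K i0) * form (K i1) (K i2) ^+ 2
  - form (K i1) (K i1) * form (K i2) (K i0) ^+ 2
  - form (K i2) (K i2) * form (K i0) (K i1) ^+ 2.

Lemma form_normal K i : form (normal K) (K i) = 0.
Proof.
rewrite /normal /Delta1 /Delta2 /Delta3 /Delta4 !det3E /form /=.
by move: i; apply: ord3_ind; field.
Qed.

(** The square of a cross product is the Gram determinant, up to the sign of the
    determinant of the form, which is negative here. *)
Lemma form_normal_normal K : form (normal K) (normal K) = - gramdet K.
Proof.
rewrite /gramdet /normal /Delta1 /Delta2 /Delta3 /Delta4 !det3E /form /=.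
case: (K i0) (K i1) (K i2) => [a0 b0 c0 d0] [a1 b1 c1 d1] [a2 b2 c2 d2] /=.
by field.
Qed.

Definition cross (p r : quadruple R -> R) X Y : R := p X * r Y - r X * p Y.

(** The orthogonal complement of the three circles is the line spanned by their
    normal, as soon as the latter is not isotropic. *)
Lemma normal_span K X Y : form (normal K) (normal K) != 0 ->
  (forall i, form X (K i) = form Y (K i)) ->
  exists s, X = lincomb 1 Y s (normal K).
Proof.
set N := normal K => N0 XY; pose Z := lincomb 1 X (-1) Y.
have Z0 i : form Z (K i) = 0 by rewrite form_lincombl XY; ring.
(* Each minor of the pair (Z, N) is a combination of the products <Z, K i>,
   whose coefficients are minors of the pairs of circles: the complementary
   ones, once lowering indices with the form has exchanged a and d. *)
pose L u w := form Z (K i0) * cross u w (K i1) (K i2)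
            + form Z (K i1) * cross u w (K i2) (K i0)
            + form Z (K i2) * cross u w (K i0) (K i1).
have L0 u w : L u w = 0 by rewrite /L !Z0; ring.
have eab : cross (@ca R) (@cb R) Z N = 0.
  rewrite -(L0 (@ca R) (@cc R)) /L /cross /N /= /Delta2 /Delta4 !det3E /form /=.
  by field.
have eac : cross (@ca R) (@cc R) Z N = 0.
  rewrite -[RHS]oppr0 -(L0 (@ca R) (@cb R)) /L /cross /N /= /Delta3 /Delta4.
  by rewrite !det3E /form /=; field.
have ead : cross (@ca R) (@cd R) Z N = 0.
  rewrite -(mulr0 2) -(L0 (@cb R) (@cc R)) /L /cross /N /= /Delta1 /Delta4.
  by rewrite !det3E /form /=; field.
have ebc : cross (@cb R) (@cc R) Z N = 0.
  rewrite -(mulr0 (- (1 / 2))) -(L0 (@ca R) (@cd R))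
    /L /cross /N /= /Delta2 /Delta3.
  by rewrite !det3E /form /=; field.
have ebd : cross (@cb R) (@cd R) Z N = 0.
  rewrite -[RHS]oppr0 -(L0 (@cc R) (@cd R)) /L /cross /N /= /Delta1 /Delta2.
  by rewrite !det3E /form /=; field.
have ecd : cross (@cc R) (@cd R) Z N = 0.
  rewrite -(L0 (@cb R) (@cd R)) /L /cross /N /= /Delta1 /Delta3 !det3E /form /=.
  by field.
(* Contracting the minors with N gives <N, N> Z = <Z, N> N by coordinates. *)
exists (form Z N / form N N).
have N1 (p : quadruple R -> R) : p Z = p X - p Y ->
    form N N * p Z = form Z N * p N -> p X = 1 * p Y + form Z N / form N N * p N.
  move=> pZ pNZ; rewrite mul1r mulrAC -pNZ mulrAC mulfV // pZ; ring.
have formE A B : form A B = cb A * cb B + cc A * cc B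
    - (ca A * cd B + cd A * ca B) / 2 by [].
case: X XY @Z Z0 L L0 eab eac ead ebc ebd ecd N1 formE => a b c d.
move=> _ Z _ _ _ eab eac ead ebc ebd ecd N1 formE.
rewrite /lincomb; congr Quadruple.
- apply: (N1 (@ca R)); first by rewrite /=; ring.
  apply/subr0_eq; transitivity (cb N * cross (@ca R) (@cb R) Z N
     + cc N * cross (@ca R) (@cc R) Z N
     - ca N / 2 * cross (@ca R) (@cd R) Z N).
    by rewrite !formE /cross; field.
  by rewrite eab eac ead; ring.
- apply: (N1 (@cb R)); first by rewrite /=; ring.
  apply/subr0_eq; transitivity (cc N * cross (@cb R) (@cc R) Z N
     + cd N / 2 * cross (@ca R) (@cb R) Z N
     - ca N / 2 * cross (@cb R) (@cd R) Z N).
    by rewrite !formE /cross; field.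
  by rewrite ebc eab ebd; ring.
- apply: (N1 (@cc R)); first by rewrite /=; ring.
  apply/subr0_eq; transitivity (- cb N * cross (@cb R) (@cc R) Z N
     + cd N / 2 * cross (@ca R) (@cc R) Z N
     - ca N / 2 * cross (@cc R) (@cd R) Z N).
    by rewrite !formE /cross; field.
  by rewrite ebc eac ecd; ring.
- apply: (N1 (@cd R)); first by rewrite /=; ring.
  apply/subr0_eq; transitivity (- cb N * cross (@cb R) (@cd R) Z N
     - cc N * cross (@cc R) (@cd R) Z N
     + cd N / 2 * cross (@ca R) (@cd R) Z N).
    by rewrite !formE /cross; field.
  by rewrite ebd ecd ead; ring.
Qed.

(** * The dual sum *)

(** If [tripleU K] is nonzero and the circles are oriented, the sum of the basis
    dual to the [K i] for [form] in their span, multiplied by [tripleU K]; see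
    [form_dualsum_circle]. *)
Definition dualsum K : quadruple R :=
  let coord p := \sum_(i < 3) p (K i) * triplev K (ordS i) in
  Quadruple (coord (@ca R)) (coord (@cb R)) (coord (@cc R)) (coord (@cd R)).

Lemma form_dualsum K Y :
  form (dualsum K) Y = \sum_(i < 3) form (K i) Y * triplev K (ordS i).
Proof. by rewrite /form /dualsum /= !big_cycle3 /=; field. Qed.

Section Oriented.
Variable K : 'I_3 -> quadruple R.
Hypothesis hK : forall i, oriented (K i).

Local Notation q := (tripleQ K).
Local Notation U := (tripleU K).

Lemma form_consecutive i : form (K i) (K (ordS i)) = 1 - 2 * q i.
Proof. by rewrite cos_invQ. Qed.

Lemma form_self i : form (K i) (K i) = 1.
Proof. exact/orientedE. Qed.

Lemma form01 : form (K i0) (K i1) = 1 - 2 * q i0.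
Proof. by rewrite -form_consecutive ordS3. Qed.
Lemma form12 : form (K i1) (K i2) = 1 - 2 * q i1.
Proof. by rewrite -form_consecutive ordS3. Qed.
Lemma form20 : form (K i2) (K i0) = 1 - 2 * q i2.
Proof. by rewrite -form_consecutive ordS3. Qed.

(** In terms of the invariants Q, the Gram determinant of three unit vectors is
    - 4 U. *)
Lemma form_normal_oriented : form (normal K) (normal K) = 4 * U.
Proof.
rewrite form_normal_normal /gramdet !form_self form01 form12 form20.
by rewrite /tripleU !big_cycle3 !ordS3 /=; ring.
Qed.

(** The coefficients v_j of the K_i are the row sums of the adjugate Gram
    matrix, divided by - 4. *)
Lemma form_dualsum_circle i : form (dualsum K) (K i) = U.
Proof.
rewrite form_dualsum !big_cycle3 /triplev !ordS3; move: i.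
apply: ord3_ind; rewrite ?form_self.
- rewrite form20 (formC (K i1)) form01.
  by rewrite /tripleU !big_cycle3 !ordS3 /=; ring.
- rewrite form01 (formC (K i2)) form12.
  by rewrite /tripleU !big_cycle3 !ordS3 /=; ring.
- rewrite form12 (formC (K i0)) form20.
  by rewrite /tripleU !big_cycle3 !ordS3 /=; ring.
Qed.

Lemma form_dualsum_normal : form (dualsum K) (normal K) = 0.
Proof.
by rewrite form_dualsum big1 // => i _; rewrite formC form_normal mul0r.
Qed.

Lemma form_dualsum_dualsum :
  form (dualsum K) (dualsum K) = U * (U - 4 * \prod_(i < 3) q i).
Proof.
rewrite form_dualsum.
under eq_bigr => i _ do rewrite formC form_dualsum_circle.
rewrite -mulr_sumr; congr (_ * _).
by rewrite /triplev /tripleU !big_cycle3 !ordS3 /=; ring.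
Qed.

(** * The solutions *)

(** The point with parameter [t] on the affine line of all X such that
    [form (K i) X = kappa] for each i; it need not be normalized. *)
Definition angle_line (kappa t : R) : quadruple R :=
  lincomb (kappa / U) (dualsum K) (t / U) (normal K).

Hypothesis hU : U != 0.

Lemma form_angle_line_circle kappa t i : form (K i) (angle_line kappa t) = kappa.
Proof.
by rewrite formC form_lincombl form_dualsum_circle form_normal; field.
Qed.

Lemma oriented_angle_line kappa t :
  oriented (angle_line kappa t) <-> t ^+ 2 = discrD K kappa.
Proof.
rewrite orientedE.
have -> : form (angle_line kappa t) (angle_line kappa t)
    = 1 + 4 / U * (t ^+ 2 - discrD K kappa).
  rewrite form_lincombl !form_lincombr (formC (normal K) (dualsum K)).
  rewrite form_dualsum_normal form_dualsum_dualsum form_normal_oriented.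
  by rewrite /discrD; field.
split=> [|->]; last by ring.
rewrite -[RHS]addr0 => /addrI/eqP.
by rewrite !mulf_eq0 invr_eq0 (negPf hU) pnatr_eq0 subr_eq0 /= => /eqP.
Qed.

(** A solution has the same products with the circles as the point of [angle_line]
    with parameter 0, so it lies on the line; normalization does the rest. *)
Lemma solutionE kappa (K0 : quadruple R) :
  is_solution K kappa K0 <->
  exists2 t, t ^+ 2 = discrD K kappa & K0 = angle_line kappa t.
Proof.
split=> [[oK0 angle] | [t tD ->]]; last first.
  by split=> [|i]; [exact/oriented_angle_line |
    rewrite cos_invQ form_angle_line_circle].
have NN0 : form (normal K) (normal K) != 0.
  by rewrite form_normal_oriented mulf_neq0 ?pnatr_eq0.
have [|s K0E] := @normal_span K K0 (angle_line kappa 0) NN0.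
  by move=> i; rewrite !(formC _ (K i)) -cos_invQ angle form_angle_line_circle.
have {}K0E : K0 = angle_line kappa (s * U).
  by rewrite K0E /angle_line /lincomb /=; congr Quadruple; field.
by exists (s * U) => //; apply/oriented_angle_line; rewrite -K0E.
Qed.

End Oriented.

Lemma K0_signE s K kappa :
  K0_sign s K kappa = angle_line K kappa (s * Num.sqrt (discrD K kappa)).
Proof. by rewrite /K0_sign /angle_line /lincomb; congr Quadruple => /=; ring. Qed.

Lemma discrDN K kappa : discrD K (- kappa) = discrD K kappa.
Proof. by rewrite /discrD sqrrN. Qed.

Lemma reverse_angle_line K kappa t :
  reverse (angle_line K kappa t) = angle_line K (- kappa) (- t).
Proof. by rewrite /reverse /angle_line /lincomb; congr Quadruple => /=; ring. Qed.

End Form.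

Arguments angle_line {R} K kappa t.

Theorem mainTheorem4 (R : realType) (K : 'I_3 -> quadruple R) (kappa : R)
    (hK : forall i : 'I_3, oriented (K i)) (hU : tripleU K <> 0) :
  ((exists K0 : quadruple R, is_solution K kappa K0) <-> 0 <= discrD K kappa)
  /\ (0 <= discrD K kappa ->
      (forall K0 : quadruple R,
          is_solution K kappa K0 <->
          K0 = K0_plus K kappa \/ K0 = K0_minus K kappa)
      /\ K0_plus K kappa = reverse (K0_minus K (- kappa))).
Proof.
have U0 : tripleU K != 0 by apply/eqP.
have solE := @solutionE R K hK U0 kappa.
split; last move=> D0.
  split=> [[K0 /solE[t <- _]] | D0]; first exact: sqr_ge0.
  exists (angle_line K kappa (Num.sqrt (discrD K kappa))); apply/solE.
  by exists (Num.sqrt (discrD K kappa)); rewrite ?sqr_sqrtr.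
rewrite /K0_plus /K0_minus !K0_signE discrDN reverse_angle_line.
rewrite opprK mulN1r opprK mul1r.
split=> // K0; split=> [/solE[t tD ->] | K0E].
  have : t ^+ 2 == Num.sqrt (discrD K kappa) ^+ 2 by rewrite sqr_sqrtr // tD.
  rewrite eqf_sqr => /orP[/eqP->|/eqP->].
  - by left.
  - by right.
case: K0E => ->; apply/solE.
- by exists (Num.sqrt (discrD K kappa)); rewrite ?sqr_sqrtr.
- by exists (- Num.sqrt (discrD K kappa)); rewrite ?sqrrN ?sqr_sqrtr.
Qed.
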